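(* Let $G$ be a connected graph of order $n(G)\ge 2$. Then $1\le \mathrm{gt}(G)\le n(G)-1$. Moreover, $\mathrm{gt}(G)=1$ if and only if $G$ is a subdivided star, and $\mathrm{gt}(G)=n(G)-1$ if and only if $G$ is a complete graph of order at least $2$.
   Context: Graphs are finite and simple; $n(G)$ denotes the number of vertices of $G$. A geodesic in $G$ is a shortest path between two vertices; a geodesic is maximal if it is not a (proper) subpath of a longer geodesic. A geodesic-transversal set of $G$ is a set $S\subseteq V(G)$ such that every maximal geodesic of $G$ contains at least one vertex of $S$. The geodesic-transversal number $\mathrm{gt}(G)$ is the minimum cardinality of a geodesic-transversal set of $G$. A subdivided star is a graph obtained from a star $K_{1,k}$, $k\ge 1$, by subdividing each of its edges an arbitrary number of times (possibly zero, and possibly different for different edges). *)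

(* Defs.v *)
From mathcomp Require Import all_boot.
From mathcomp Require Import boolp.

Set Implicit Arguments.
Unset Strict Implicit.
Unset Printing Implicit Defensive.

(** * Finite simple graphs *)

Record sgraph := SGraph {
  svertex :> finType;
  adj : rel svertex;
  adj_sym : symmetric adj;
  adj_irrefl : irreflexive adj }.

Definition connected (G : sgraph) : Prop := forall x y : G, connect (@adj G) x y.

Definition complete (G : sgraph) : Prop := forall x y : G, x != y -> adj x y.

Definition isomorphic (G H : sgraph) : Prop :=
  exists2 f : G -> H, bijective f & forall x y, adj (f x) (f y) = adj x y.

(** * Geodesics *)

(* A path is the sequence of its vertices, read from one end to the other, so
   an undirected path with at least one edge is represented by two sequences,
   [s] and [rev s]. A single vertex is a path. *)
Definition path_between (G : sgraph) (x y : G) (s : seq G) : bool :=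
  [&& s != [::], head x s == x, last y s == y, sorted (@adj G) s & uniq s].

Definition geodesic (G : sgraph) (s : seq G) : Prop :=
  exists x y : G, path_between x y s /\
    forall t, path_between x y t -> size s <= size t.

(* Subpaths are contiguous subsequences. Reversals need not be considered
   explicitly: [rev t] is a geodesic whenever [t] is. *)
Definition maximal_geodesic (G : sgraph) (s : seq G) : Prop :=
  geodesic s /\ ~ exists t, [/\ geodesic t, infix s t & size s < size t].

Definition gt_set (G : sgraph) (S : {set G}) : Prop :=
  forall s : seq G, maximal_geodesic s -> exists2 x, x \in s & x \in S.

Lemma gt_setT (G : sgraph) : gt_set [set: G].
Proof.
by case=> [|x s] [[u [v [/and5P[// _ _ _ _] _]]] _]; exists x; rewrite ?mem_head ?inE.
Qed.

Definition gt (G : sgraph) : nat :=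
  #|[arg min_(S < [set: G] | `[< gt_set S >]) #|S|]|.

Lemma gt_spec (G : sgraph) :
  (exists2 S : {set G}, gt_set S & #|S| = gt G) /\
  (forall S : {set G}, gt_set S -> gt G <= #|S|).
Proof.
rewrite /gt; case: arg_minnP; first exact/asboolP/gt_setT.
move=> S /asboolP gtS minS; split; first by exists S.
by move=> S' gtS'; apply/minS/asboolP.
Qed.

(** * Subdivided stars *)

Section Star.
Variable k : nat.

(* [None] is the centre. *)
Definition star_adj : rel (option 'I_k) := fun x y => isSome x (+) isSome y.

Lemma star_adj_sym : symmetric star_adj.
Proof. by move=> x y; rewrite /star_adj addbC. Qed.

Lemma star_adj_irrefl : irreflexive star_adj.
Proof. by move=> x; rewrite /star_adj addbb. Qed.

Definition star : sgraph := SGraph star_adj_sym star_adj_irrefl.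

End Star.

Section SubdivideEdge.
Variables (G : sgraph) (u v : G).

(* The edge [uv] is removed, and the new vertex [None] is joined to [u] and
   [v]. *)
Definition subdivide_adj : rel (option G) := fun a b =>
  match a, b with
  | Some x, Some y => adj x y && ([set x; y] != [set u; v])
  | Some x, None | None, Some x => x \in [set u; v]
  | None, None => false
  end.

Lemma subdivide_adj_sym : symmetric subdivide_adj.
Proof. by case=> [x|] [y|] //=; rewrite adj_sym setUC. Qed.

Lemma subdivide_adj_irrefl : irreflexive subdivide_adj.
Proof. by case=> [x|] //=; rewrite adj_irrefl. Qed.

Definition subdivide : sgraph := SGraph subdivide_adj_sym subdivide_adj_irrefl.

End SubdivideEdge.

(* [subdivision H G]: up to isomorphism, [G] arises from [H] by finitely many
   single-edge subdivisions. Subdividing an edge of [H] several times means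
   subdividing again one of the edges that replaced it. *)
Inductive subdivision (H : sgraph) : sgraph -> Prop :=
| subdivision_iso (G : sgraph) : isomorphic H G -> subdivision H G
| subdivision_step (G G' : sgraph) (u v : G) :
    subdivision H G -> adj u v -> isomorphic (subdivide u v) G' ->
    subdivision H G'.

Definition subdivided_star (G : sgraph) : Prop :=
  exists2 k : nat, 1 <= k & subdivision (star k) G.

(* Main.v *)
(* If every maximal geodesic passes through [x], then extending an edge, or a path
   [abc] with [a] and [c] nonadjacent, to a maximal geodesic shows that adjacent
   vertices are at different distances from [x], and that each vertex other than
   [x] has exactly one neighbour closer to [x] and at most one farther from it.
   So [G] is a union of legs hanging from [x], i.e. a subdivided star;
   conversely, in a subdivided star a geodesic avoiding the centre lies
   inside a single leg and can be prolonged towards the centre.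
   For the upper bound, a maximal geodesic contains an edge, so the complement of
   a vertex, and even of two nonadjacent vertices, is transversal. *)

Require Import Defs.
From mathcomp Require Import all_boot.
From mathcomp Require Import boolp zify.

Set Implicit Arguments.
Unset Strict Implicit.
Unset Printing Implicit Defensive.

(** * Distances and geodesics in a connected graph *)

Section Distance.
Variables (G : sgraph) (G_conn : connected G).
Implicit Types (a b c x y z : G) (s t : seq G).

(** Tuples make the existence of a walk of length [n] boolean, so that [ex_minn] can select the
    least length. *)
Definition walk n a b := [exists t : n.-tuple G, path (@adj G) a t && (last a t == b)].

Lemma walkP n a b :
  reflect (exists s, [/\ path (@adj G) a s, last a s = b & size s = n]) (walk n a b).
Proof.
apply: (iffP existsP) => [[t /andP[pt /eqP lt]]|[s [ps ls sz]]].
  by exists t; rewrite size_tuple.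
by exists (tcast sz (in_tuple s)); rewrite val_tcast ps ls eqxx.
Qed.

Lemma walk_exists a b : exists n, walk n a b.
Proof.
by have /connectP[s ps ls] := G_conn a b; exists (size s); apply/walkP; exists s.
Qed.

Definition dist a b := ex_minn (walk_exists a b).

Lemma dist_walk a b :
  exists s, [/\ path (@adj G) a s, last a s = b & size s = dist a b].
Proof. by rewrite /dist; case: ex_minnP => n /walkP. Qed.

Lemma dist_le a s : path (@adj G) a s -> dist a (last a s) <= size s.
Proof. by move=> ps; rewrite /dist; case: ex_minnP => n _; apply; apply/walkP; exists s. Qed.

Lemma dist_eq0 a b : (dist a b == 0) = (a == b).
Proof.
apply/eqP/eqP => [d0|->].
  by have [s [_ + sz]] := dist_walk a b; rewrite (size0nil (etrans sz d0)).
by apply/eqP; rewrite -leqn0; exact: (@dist_le b [::]).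
Qed.

Lemma distxx a : dist a a = 0.
Proof. by apply/eqP; rewrite dist_eq0. Qed.

Lemma dist_sym a b : dist a b = dist b a.
Proof.
suff le u v : dist u v <= dist v u by apply/eqP; rewrite eqn_leq !le.
have [s [ps ls sz]] := dist_walk v u.
have := @dist_le (last v s) (rev (belast v s)).
rewrite rev_path size_rev size_belast sz ls.
have -> : last u (rev (belast v s)) = v.
  by rewrite -{1}ls; case: s {ps ls sz} => //= c s; rewrite rev_cons last_rcons.
by apply; rewrite (eq_path (e' := @adj G)) // => ? ?; rewrite adj_sym.
Qed.

Lemma dist_triangle a b c : dist a c <= dist a b + dist b c.
Proof.
have [s [ps ls <-]] := dist_walk a b; have [t [pt lt <-]] := dist_walk b c.
by have := @dist_le a (s ++ t); rewrite cat_path last_cat ls lt size_cat ps pt; apply.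
Qed.

Lemma dist_adj a b : adj a b -> dist a b = 1.
Proof.
move=> ab; apply/eqP; rewrite eqn_leq lt0n dist_eq0.
have -> : a != b by apply: contraTneq ab => ->; rewrite adj_irrefl.
by have := @dist_le a [:: b]; rewrite /= ab => ->.
Qed.

Lemma dist_adjl a b c : adj a b -> dist a c <= (dist b c).+1.
Proof. by move=> ab; have := dist_triangle a b c; rewrite (dist_adj ab). Qed.

Lemma dist_pred a b : a != b -> exists2 c, adj a c & dist a b = (dist c b).+1.
Proof.
move=> ab; have [[|c s] [/= ps ls sz]] := dist_walk a b; first by rewrite ls eqxx in ab.
have /andP[ac pcs] := ps; exists c => //; apply/eqP; rewrite eqn_leq dist_adjl //=.
by have := dist_le pcs; rewrite ls -sz.
Qed.

(** Minimality among simple paths is the same as minimality among walks: every walk shortens to a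
    simple path with the same ends, and a shortest walk is already simple. *)
Lemma geodesicP a s :
  geodesic (a :: s) <-> path (@adj G) a s /\ dist a (last a s) = size s.
Proof.
split=> [[x [y [/and5P[_ /= /eqP <- /eqP <- ps _] mins]]]|[ps ds]].
  split=> //; apply/eqP; rewrite eqn_leq dist_le //=.
  have [t [pt lt <-]] := dist_walk a (last a s); rewrite -lt in mins *.
  case/shortenP: pt mins => t' pt' ut' tt' mins.
  have := mins (a :: t'); rewrite /path_between /= !eqxx pt' -/(uniq (a :: t')) ut' /=.
  move=> /(_ isT); rewrite ltnS => /leq_trans; apply.
  by apply: uniq_leq_size tt'; case/andP: ut'.
have us : uniq (a :: s).
  (* The shortened walk [t] is duplicate-free, lies inside [s], and is no shorter since [s] attains
     the distance; hence [s] has no repetition either. *)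
  case/shortenP: (ps) ds => t pt ut ts ds.
  apply: (leq_size_uniq ut); last by rewrite /= ltnS -ds dist_le.
  by move=> z; rewrite !inE => /orP[->//|/ts ->]; rewrite orbT.
exists a, (last a s); split; first by rewrite /path_between /= !eqxx ps -/(uniq (a :: s)) us.
case=> [|b t] /and5P[//= _ /eqP-> /eqP lt pt _].
by rewrite ltnS -ds -lt dist_le.
Qed.

Lemma geodesic_sorted s : geodesic s -> sorted (@adj G) s.
Proof. by case: s => // a s /geodesicP[]. Qed.

Lemma geodesic_uniq s : geodesic s -> uniq s.
Proof. by move=> [x [y [/and5P[]]]]. Qed.

Lemma geodesic_neq0 s : geodesic s -> s != [::].
Proof. by move=> [x [y [/and5P[]]]]. Qed.

Lemma geodesic_rev s : geodesic s -> geodesic (rev s).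
Proof.
have rev_between (u v : G) t : path_between u v t -> path_between v u (rev t).
  case/and5P=> t0 hd lt st ut.
  rewrite /path_between -size_eq0 size_rev size_eq0 t0 rev_uniq ut rev_sorted.
  rewrite (eq_sorted (e' := @adj G)) ?st => [|? ?]; last by rewrite adj_sym.
  case: t t0 hd lt {st ut} => // c t _ /= hd; rewrite (eqP hd) {hd c}.
  case/lastP: t => [|t c]; first by move=> /= /eqP ->; rewrite /= !eqxx.
  by rewrite last_rcons => /eqP->; rewrite -rcons_cons rev_rcons rev_cons /= last_rcons !eqxx.
move=> [x [y [pxy mins]]]; exists y, x; split; first exact: rev_between.
by move=> t /rev_between/mins; rewrite !size_rev.
Qed.

(** The three segments cut out by [i] and [j] bound the distances of their ends from above, and
    these bounds add up to the distance between the ends of [s]; the triangle inequality then makes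
    each of them exact. *)
Lemma geodesic_dist s z i j :
  geodesic s -> i <= j < size s -> dist (nth z s i) (nth z s j) = j - i.
Proof.
move=> gs; case/andP=> ij js.
have le k l : k <= l -> l < size s -> dist (nth z s k) (nth z s l) <= l - k.
  elim: l => [|l IH]; first by rewrite leqn0 => /eqP-> _; rewrite distxx.
  rewrite leq_eqVlt => /predU1P[-> _|kl ls]; first by rewrite distxx.
  have := dist_triangle (nth z s k) (nth z s l) (nth z s l.+1).
  have /(sortedP z)/(_ l ls)/dist_adj-> := geodesic_sorted gs.
  have := IH kl (ltnW ls); lia.
have full : dist (nth z s 0) (nth z s (size s).-1) = (size s).-1.
  by case: s gs {js le} => [/geodesic_neq0|a s /geodesicP[_]] //; rewrite nth_last.
have := le _ _ ij js; have := le 0 i isT (leq_ltn_trans ij js).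
have := le j (size s).-1.
have := dist_triangle (nth z s 0) (nth z s i) (nth z s (size s).-1).
have := dist_triangle (nth z s i) (nth z s j) (nth z s (size s).-1).
lia.
Qed.

Lemma geodesic1 a : geodesic [:: a].
Proof. by apply/geodesicP; rewrite /= distxx. Qed.

Lemma geodesic2 a b : adj a b -> geodesic [:: a; b].
Proof. by move=> ab; apply/geodesicP; rewrite /= ab dist_adj. Qed.

Lemma geodesic3 a b c :
  adj a b -> adj b c -> a != c -> ~~ adj a c -> geodesic [:: a; b; c].
Proof.
move=> ab bc ac nac; apply/geodesicP; rewrite /= ab bc; split=> //.
have [e ae dac] := dist_pred ac; rewrite dac.
have : dist e c != 0 by rewrite dist_eq0; apply: contraNneq nac => <-.
have := dist_triangle a b c; rewrite dac (dist_adj ab) (dist_adj bc); lia.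
Qed.

(** Geodesics repeat no vertex, so their sizes are bounded by [#|G|] and prolonging must stop. *)
Lemma maximal_extension s : geodesic s -> exists2 t, maximal_geodesic t & infix s t.
Proof.
have [n] := ubnP (#|G| - size s); elim: n s => // n IH s le gs.
have [[t [gt st lt]]|nex] := EM (exists t, [/\ geodesic t, infix s t & size s < size t]).
  have [|r mr tr] := IH t _ gt; last by exists r => //; exact: infix_trans tr.
  have := max_card (mem t); rewrite (card_uniqP (geodesic_uniq gt)); lia.
by exists s; rewrite ?infix_refl.
Qed.

Lemma maximal_geodesic_rev s : maximal_geodesic s -> maximal_geodesic (rev s).
Proof.
move=> [gs ms]; split=> [|[t [gt st lt]]]; first exact: geodesic_rev.
apply: ms; exists (rev t); split; [exact: geodesic_rev | by rewrite -infix_revLR |].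
by move: lt; rewrite !size_rev.
Qed.

Lemma neighbour_exists x : 2 <= #|G| -> exists y, adj x y.
Proof.
move=> /card_gt1P[u [v [_ _ uv]]].
have [y yx] : exists y, y != x.
  by have [ux|] := eqVneq u x; [exists v; rewrite eq_sym -ux | exists u].
by rewrite eq_sym in yx; have [z xz _] := dist_pred yx; exists z.
Qed.

End Distance.

(** * Subdivided stars encoded by a parent function *)

Section Spider.
Variables (G : sgraph) (x : G) (p : G -> G).

Definition parent_rel : rel G := fun a b => (a != x) && (p a == b).

(* [G] is a subdivided star centred at [x]: [p] maps every other vertex to its
   neighbour towards [x], so that distinct vertices have distinct parents unless
   the parent is [x]. The rank [d] only makes the iterates of [p] reach [x]; it
   need not be the distance to [x], which keeps it easy to update. *)
Definition spider (d : G -> nat) : Prop :=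
  [/\ forall a, a != x -> d (p a) < d a,
      forall a b, adj a b = parent_rel a b || parent_rel b a
    & forall a b, a != x -> b != x -> p a = p b -> p a != x -> a = b].

End Spider.

(** The rank may drop by more than one from a vertex to its parent. The number of iterations of [p]
    needed to reach [x] drops by exactly one, so it can measure lengths. *)
Lemma spider_depth (G : sgraph) (x : G) p d : spider x p d ->
  exists e : G -> nat, forall a, a != x -> e a = (e (p a)).+1.
Proof.
move=> [dp _ _].
have ex a : exists n, iter n p a == x.
  have [n] := ubnP (d a); elim: n a => // n IH a le.
  have [->|ax] := eqVneq a x; first by exists 0.
  have [|m pm] := IH (p a); first exact: leq_trans (dp a ax) le.
  by exists m.+1; rewrite iterSr.
exists (fun a => ex_minn (ex a)) => a ax.
case: ex_minnP => -[|n]; first by rewrite /= (negbTE ax).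
rewrite iterSr => pn minn; case: ex_minnP => m pm minm.
congr _.+1; apply/eqP; rewrite eqn_leq minm // andbT.
by rewrite -ltnS minn // iterSr.
Qed.

Section SpiderTheory.
Variables (G : sgraph) (x : G) (p : G -> G) (d : G -> nat).
Hypothesis spG : spider x p d.

Lemma spider_parent_neq a : a != x -> p a != a.
Proof. by case: spG => dp _ _ /dp; apply: contraTneq => ->; rewrite ltnn. Qed.

Lemma spider_iso (H : sgraph) (f : G -> H) :
  bijective f -> (forall a b, adj (f a) (f b) = adj a b) ->
  exists y q e, @spider H y q e.
Proof.
case: spG => dp adjE inj_p [g fK gK] fadj.
have gx a : (a != f x) = (g a != x) by rewrite -(inj_eq (can_inj gK)) fK.
exists (f x), (f \o p \o g), (d \o g); split=> [a|a b|a b] /=.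
- by rewrite gx fK => /dp.
- by rewrite -{1}[a]gK -{1}[b]gK fadj adjE /parent_rel !gx -!(can2_eq fK gK).
- by rewrite !gx fK => ax bx /(can_inj fK) pab pax; apply/(can_inj gK)/inj_p.
Qed.

Lemma spider_subdivide u v : v != x -> p v = u ->
  exists y q e, @spider (subdivide u v) y q e.
Proof.
case: spG => dp adjE inj_p vx pv.
have uv : u != v by rewrite -pv spider_parent_neq.
pose q (z : option G) :=
  if z is Some a then if a == v then None else Some (p a) else Some u.
(* Doubling the ranks leaves room for the new vertex just below [v] and still above [u]. *)
pose e (z : option G) := if z is Some a then (d a).*2 else (d v).*2.-1.
have SE (a b : G) : (Some a == Some b) = (a == b) by [].
have no_cycle : (u != x) && (p u == v) = false.
  apply/negP => /andP[/dp + /eqP pu]; rewrite pu; have := dp v vx; rewrite pv; lia.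
(* Removing the edge [uv] cuts [v] from its parent only, so its remaining neighbours are its
   children. *)
have adj_v b : b != v ->
    adj v b && ([set v; b] != [set u; v]) = parent_rel x p b v.
  move=> bv; rewrite adjE /parent_rel vx pv /=.
  have [<-|ub] := eqVneq u b; first by rewrite setUC eqxx andbF no_cycle.
  apply: andb_idr => _; apply: contraNneq ub => /setP/(_ u).
  by rewrite !inE eqxx (negbTE uv).
exists (Some x), q, e; split=> [[a|]|[a|] [b|]|[a|] [b|]] //=.
- by rewrite SE => /dp; have [->|_] := eqVneq a v => /=; lia.
- by move=> _; have := dp v vx; rewrite pv; lia.
- rewrite /parent_rel !SE /=.
  have [->|av] := eqVneq a v; have [->|bv] := eqVneq b v.
  + by rewrite adj_irrefl !andbF.
  + by rewrite adj_v // andbF.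
  + by rewrite adj_sym setUC adj_v // andbF orbF.
  + rewrite adjE /=; apply: andb_idr => _; apply: contraNneq av => /setP/(_ v).
    by rewrite !inE eqxx orbT eq_sym (eq_sym v b) (negbTE bv) orbF.
- rewrite !inE /parent_rel !SE /= (eq_sym u).
  by have [->|_] := eqVneq a v; rewrite ?vx /= ?orbT // andbF orbF.
- rewrite !inE /parent_rel !SE /= (eq_sym u).
  by have [->|_] := eqVneq b v; rewrite ?vx /= ?orbT // andbF !orbF.
- rewrite !SE.
  have [->|av] := eqVneq a v; have [->|bv] := eqVneq b v => // ax bx [pab].
  by rewrite SE => pax; congr Some; apply: inj_p.
- rewrite !SE; have [->//|av] := eqVneq a v => ax _ [pa] px.
  by case/eqP: av; apply: inj_p; rewrite ?pv.
- rewrite !SE; have [->//|bv] := eqVneq b v => _ bx  [pb] px.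
  by case/eqP: bv; apply: inj_p; rewrite ?pv // -pb.
Qed.

End SpiderTheory.

(** * Equivalence of the encoding with iterated subdivision of a star *)

Lemma spider_of_subdivided_star (G : sgraph) :
  subdivided_star G -> exists x p d, @spider G x p d.
Proof.
case=> k _; elim=> [{}G [f fbij fadj]|{}G G' u v _ [x [p [d sp]]] uv [f fbij fadj]].
  have sp : @spider (star k) None (fun _ => None) isSome.
    by split=> [[]|[?|] [?|]|? ? ? ? ? /eqP].
  exact: (spider_iso sp fbij fadj).
have [_ adjE _] := sp.
(* [spider_subdivide] takes the child as second endpoint. Either order will do, since the subdivided
   graph depends only on the unordered pair. *)
have [[y [q [e spS]]]|[y [q [e spS]]]] :
    (exists y q e, @spider (subdivide u v) y q e) \/
    (exists y q e, @spider (subdivide v u) y q e).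
- move: uv; rewrite adjE => /orP[]/andP[ax /eqP pE]; [right|left].
  + exact: (spider_subdivide sp ax pE).
  + exact: (spider_subdivide sp ax pE).
- exact: (spider_iso spS fbij fadj).
- apply: (spider_iso spS fbij) => a b; rewrite fadj.
  by case: a b => [a|] [b|] //=; rewrite (setUC [set u]).
Qed.

(* Undoing a subdivision: a vertex [u] which is neither the centre nor a leaf is
   removed and its two neighbours [v] and [p u] are joined. *)
Section Contract.
Variables (G : sgraph) (x : G) (p : G -> G) (d : G -> nat).
Hypothesis spG : spider x p d.
Variables (u v : G).
Hypotheses (vx : v != x) (ux : u != x) (pv : p v = u).

(** The default of [insubd] is never taken: the bypassed parent always differs from [u]. *)
Definition contract_parent (z : {z | z != u}) : {z | z != u} :=
  insubd z (if p (val z) == u then p u else p (val z)).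

Lemma val_contract_parent z :
  val (contract_parent z) = if p (val z) == u then p u else p (val z).
Proof.
rewrite val_insubd; case: (eqVneq (p (val z)) u) => [_|->//].
by rewrite (spider_parent_neq spG ux).
Qed.

Definition contract_adj : rel {z | z != u} := fun a b =>
  (val a != x) && (contract_parent a == b) ||
  (val b != x) && (contract_parent b == a).

Lemma rank_contract_parent z : val z != x -> d (val (contract_parent z)) < d (val z).
Proof.
case: spG => dp _ _ zx; rewrite val_contract_parent.
case: eqP => [pz|_]; last exact: dp.
by have := dp _ zx; rewrite pz; apply: ltn_trans (dp _ ux).
Qed.

Lemma contract_adj_sym : symmetric contract_adj.
Proof. by move=> a b; rewrite /contract_adj orbC. Qed.

Lemma contract_adj_irrefl : irreflexive contract_adj.
Proof.
move=> a; rewrite /contract_adj orbb; apply/negP => /andP[/rank_contract_parent + /eqP pa].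
by rewrite pa ltnn.
Qed.

Definition contract : sgraph := SGraph contract_adj_sym contract_adj_irrefl.

(** As [u] is not the centre, [v] is its only child. Contraction thus changes the parent of [v]
    alone, and sending the new vertex of the subdivision to [u] recovers [G]. *)
Lemma spider_contract (y a : contract) : val y = x -> val a = v ->
  [/\ spider y contract_parent (d \o val), adj a (contract_parent a)
    & isomorphic (subdivide a (contract_parent a)) G].
Proof.
case: spG => dp adjE inj_p yx av.
have vE (b c : contract) : (b == c) = (val b == val c) by [].
have pE (z : contract) : val z != v -> val z != x -> (p (val z) == u) = false.
  by move=> zv zx; apply: contra_neqF zv => /eqP pz; apply: inj_p; rewrite ?pv ?pz.
have pa : val (contract_parent a) = p u by rewrite val_contract_parent av pv eqxx.
split.
- split=> [z|b c|b c]; rewrite ?vE ?yx.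
  + exact: rank_contract_parent.
  + by rewrite /parent_rel !vE yx.
  + move=> bx cx /(congr1 val); rewrite !val_contract_parent => pbc pbx.
    apply: val_inj; move: pbc pbx.
    have [bv|bv] := eqVneq (val b) v; have [cv|cv] := eqVneq (val c) v.
    * by rewrite bv cv.
    (* A vertex sharing the new parent of [v] would have the same parent as [u] in [G], hence be the
       removed vertex [u]. *)
    * rewrite bv pv eqxx pE // => puc pux.
      by case/eqP: (valP c); apply/esym/inj_p.
    * rewrite cv pv eqxx pE // => pbu pbx.
      by case/eqP: (valP b); apply/inj_p.
    * by rewrite !pE //; apply: inj_p.
- by rewrite /= /contract_adj av vx eqxx.
pose f (z : option contract) := if z is Some b then val b else u.
exists f.
  have f_inj : injective f.
    by move=> [b|] [c|] //= => [/val_inj->|E|E] //; [case/eqP: (valP b)|case/eqP: (valP c)].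
  apply: (inj_card_bij f_inj); rewrite card_option card_sig.
  have -> : #|[pred z | z != u]| = #|predC1 u| by apply: eq_card.
  rewrite cardC1.
  by have : 0 < #|G| by [apply/card_gt0P; exists u]; lia.
have fadj_u b : adj (f None) (f (Some b)) = (b \in [set a; contract_parent a]).
  rewrite /= !inE !vE av pa adjE /parent_rel ux (eq_sym (p u)) [RHS]orbC.
  congr (_ || _).
  have [->|bv] := eqVneq (val b) v; first by rewrite vx pv eqxx.
  have [bx|bx] := eqVneq (val b) x; first by [].
  by rewrite pE.
pose R (b c : contract) := (val b != x) && (contract_parent b == c).
(* Between old vertices, [G] keeps every parent edge of the contraction except that of [a], which is
   routed through [u]. *)
have relE b c : parent_rel x p (val b) (val c) = (b != a) && R b c.
  rewrite /parent_rel /R !vE av val_contract_parent.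
  have [->|bv] := eqVneq (val b) v; first by rewrite pv (eq_sym u) (negbTE (valP c)) andbF.
  by have [//|bx] := eqVneq (val b) x; rewrite pE.
have no_cycle : R (contract_parent a) a = false.
  apply/negP => /andP[/rank_contract_parent + /eqP Ea]; rewrite Ea.
  have ax : val a != x by rewrite av.
  by have := rank_contract_parent ax; lia.
have adj_a c : c != a ->
    contract_adj a c && ([set a; c] != [set a; contract_parent a]) = R c a.
  move=> ca; rewrite /contract_adj av vx /= -/(R c a).
  have [<-|ac] := eqVneq (contract_parent a) c; first by rewrite eqxx andbF no_cycle.
  apply: andb_idr => _; apply: contraNneq ac => /setP/(_ c).
  by rewrite !inE eqxx orbT (negbTE ca) eq_sym /= => <-.
move=> [b|] [c|].
- rewrite /= adjE !relE.
  have [->|ba] := eqVneq b a; have [->|ca] := eqVneq c a.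
  + by rewrite contract_adj_irrefl.
  + by rewrite adj_a.
  + by rewrite contract_adj_sym setUC adj_a // orbF.
  + rewrite [RHS]andb_idr // => _; apply: contraNneq ba => /setP/(_ a).
    by rewrite !inE eqxx eq_sym (eq_sym a c) (negbTE ca) orbF.
- by rewrite adj_sym fadj_u.
- by rewrite fadj_u.
- by rewrite /= adj_irrefl.
Qed.

End Contract.

(** Induction on the order: as long as some parent is not the centre, it is contracted. Otherwise
    every other vertex hangs directly from [x], and the graph is a star. *)
Lemma subdivided_star_of_spider (G : sgraph) (x : G) p d :
  2 <= #|G| -> spider x p d -> subdivided_star G.
Proof.
have [n] := ubnP #|G|; elim: n G x p d => // n IH G x p d le G2 sp.
have [dp adjE inj_p] := sp.
have [/existsP[v /andP[vx pvx]]|/existsPn px] :=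
    boolP [exists v, (v != x) && (p v != x)].
  have xu : x != p v by rewrite eq_sym.
  have vu : v != p v by rewrite eq_sym (spider_parent_neq sp).
  have cardH : #|contract sp pvx| = #|G|.-1.
    rewrite card_sig -(cardC1 (p v)); exact: eq_card.
  have [spH aH isoH] := @spider_contract _ _ _ _ sp _ v vx pvx erefl
    (Sub x xu) (Sub v vu) erefl erefl.
  have [||k k0 subH] := IH _ _ _ _ _ _ spH.
  - by rewrite cardH; lia.
  - apply/card_gt1P; exists (Sub x xu), (Sub v vu); split=> //.
    by rewrite -val_eqE eq_sym.
  by exists k => //; apply: subdivision_step subH aH isoH.
have {}px a : a != x -> p a = x.
  by move=> ax; have := px a; rewrite ax negbK => /eqP.
exists #|predC1 x|; first by rewrite cardC1; lia.
apply: subdivision_iso.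
pose f (z : star #|predC1 x|) := if z is Some i then enum_val i else x.
have fx i : f (Some i) != x by have := enum_valP i.
exists f.
  apply: inj_card_bij => [[i|] [j|] //|].
  - by move/enum_val_inj->.
  - by move=> E; case/eqP: (fx i).
  - by move=> E; case/eqP: (fx j).
  by rewrite card_option card_ord cardC1; lia.
have fE z : (f z != x) = isSome z by case: z => [i|]; rewrite ?fx //= eqxx.
move=> y z; rewrite adjE /parent_rel !fE /= /star_adj.
case: y z => [i|] [j|] //=; rewrite px ?fx ?eqxx //.
  by rewrite (px _ (fx j)) eq_sym (negbTE (fx j)) eq_sym (negbTE (fx i)).
Qed.

(** * Transversal sets and bounds on their size *)

Section GeodesicTransversal.
Variables (G : sgraph) (G_conn : connected G).
Implicit Types (x a b c : G) (S : {set G}).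

Lemma spider_gt_set x p d : spider x p d -> gt_set [set x].
Proof.
move=> sp s; have [dp adjE inj_p] := sp; have [e ep] := spider_depth sp.
have e_adj a b : adj a b -> e a <= (e b).+1.
  by rewrite adjE => /orP[]/andP[/ep + /eqP pE]; rewrite pE; lia.
have e_dist a b : e a <= e b + dist G_conn a b.
  have [t [pt <- <-]] := dist_walk G_conn a b.
  elim: t a pt => [|c t IH] a /=; first by rewrite addn0.
  by case/andP=> /e_adj + /IH; lia.
(* Along an ascending path [e] drops by one at each step, and it cannot drop by more than the
   distance, so the path is shortest. *)
have up_geodesic a t : path (parent_rel x p) a t -> geodesic (a :: t).
  move=> pt; apply/(geodesicP G_conn).
  have adjt : path (@adj G) a t by apply: sub_path pt => b c; rewrite adjE => ->.
  have eE : e a = e (last a t) + size t.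
    elim: t a pt {adjt} => [|c t IH] a /=; first by rewrite addn0.
    by case/andP=> /andP[/ep -> /eqP->] /IH ->; rewrite addnS.
  split=> //; apply/eqP; rewrite eqn_leq dist_le //=.
  by have := e_dist a (last a t); lia.
have up_maximal a t : x \notin a :: t -> path (parent_rel x p) a t ->
    maximal_geodesic (a :: t) -> False.
  move=> xt pt [_]; apply; exists (rcons (a :: t) (p (last a t))); split.
  - apply: up_geodesic; rewrite rcons_path pt /parent_rel eqxx andbT.
    by apply: contraNneq xt => <-; apply: mem_last.
  - exact: infix_rcons.
  - by rewrite size_rcons.
move=> ms; have [xs|xs] := boolP (x \in s); first by exists x; rewrite ?inE.
(* Prolongation is done at the tail, so a descending geodesic is reversed first. *)
suff [/(_ xs ms)|/(_ _ (maximal_geodesic_rev ms))] :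
    (x \notin s -> maximal_geodesic s -> False) \/
    (x \notin rev s -> maximal_geodesic (rev s) -> False).
- by [].
- by rewrite mem_rev => /(_ xs).
have gs : geodesic s by case: ms.
(* A simple path avoiding [x] cannot turn: down then up returns to the same parent, while up then
   down needs two children of a vertex other than [x]. *)
have up_or_down :
    sorted (parent_rel x p) s \/ sorted (fun a b => parent_rel x p b a) s.
  have := geodesic_uniq gs; have := geodesic_sorted G_conn gs.
  case: s xs {ms gs} => [|a s]; first by left.
  elim: s a => [|b s IH] a; first by left.
  rewrite in_cons negb_or => /andP[xa xs] /=.
  rewrite adjE => /andP[ab pbs] /andP[abs ubs].
  case: s IH xs pbs abs ubs => [|c s] IH xs pbs abs ubs.
    by case/orP: ab => ->; [left|right].
  have [bx cx] : b != x /\ c != x.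
    by move: xs; rewrite !inE !negb_or !(eq_sym x) => /and3P[].
  have ac : a != c by move: abs; rewrite !inE !negb_or => /and3P[].
  have := IH b xs pbs ubs; rewrite /=.
  move=> [/andP[bc pcs]|/andP[cb pcs]]; case/orP: ab => ab.
  - by left; rewrite ab bc.
  - case/andP: ab bc => _ /eqP pba /andP[_ /eqP pbc].
    by rewrite -pba -pbc eqxx in ac.
  - case/andP: ab cb => ax /eqP pab /andP[_ /eqP pcb].
    by case/eqP: ac; apply: inj_p; rewrite ?pab ?pcb.
  - by right; rewrite ab cb.
case: up_or_down => up; [left|right].
  by case: s gs {ms xs} up => [/geodesic_neq0//|a s] _ up xs; apply: up_maximal.
move: up; rewrite -rev_sorted => up xr.
case: (rev s) (geodesic_rev gs) xr up => [/geodesic_neq0//|a t] _ xt pt.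
exact: up_maximal.
Qed.

(* Every edge and every path [abc] with [a], [c] nonadjacent lies on a maximal
   geodesic through [x], along which the distance to [x] is first strictly
   decreasing, then strictly increasing. So adjacent vertices are at different
   distances from [x], and so are two neighbours of a vertex other than [x]. *)
Lemma spider_of_gt_set x : gt_set [set x] -> exists p d, spider x p d.
Proof.
move=> gx; pose d a := dist G_conn a x.
(* In a maximal extension, [i] is the position of [x] and [m] the offset of [s]; the sum of
   truncated differences is the absolute value of [m + k - i]. *)
have on_geodesic s : geodesic s -> exists (i m : nat), forall k, k < size s ->
    d (nth x s k) = (m + k - i) + (i - (m + k)).
  move=> /(maximal_extension (G := G))[t mt /infixP[s1 [s2 tE]]].
  have [y yt /[!inE]/eqP yx] := gx t mt; rewrite {y}yx in yt.
  exists (index x t), (size s1) => k ks.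
  have kt : size s1 + k < size t by rewrite tE !size_cat ltn_add2l ltn_addr.
  have -> : nth x s k = nth x t (size s1 + k).
    by rewrite tE nth_cat ltnNge leq_addr /= addKn nth_cat ks.
  have xi : index x t < size t by rewrite index_mem.
  have [ge] := mt; rewrite /d -{2}(nth_index x yt).
  have [le|lt] := leqP (index x t) (size s1 + k).
    by rewrite dist_sym (geodesic_dist G_conn) ?le //; lia.
  by rewrite (geodesic_dist G_conn) ?(ltnW lt) //; lia.
have d_adj a b : adj a b -> d a = (d b).+1 \/ d b = (d a).+1.
  move=> ab; have [i [m dE]] := on_geodesic _ (geodesic2 G_conn ab).
  by have := dE 0 isT; have := dE 1 isT; rewrite /=; lia.
have d_neq a b c : b != x -> adj a b -> adj b c -> a != c -> d a != d c.
  move=> bx ab bc ac; have [ca|nac] := boolP (adj a c).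
    by have := d_adj _ _ ca; lia.
  (* Equal distances at both ends would put [x] in the middle, at [b]. *)
  have [i [m dE]] := on_geodesic _ (geodesic3 G_conn ab bc ac nac).
  have : d b != 0 by rewrite dist_eq0.
  by have := dE 0 isT; have := dE 1 isT; have := dE 2 isT; rewrite /=; lia.
(* The default is taken only at [x], the one vertex without a closer neighbour. *)
pose p a := odflt x [pick b | adj a b & d b < d a].
have pP a : a != x -> adj a (p a) /\ d a = (d (p a)).+1.
  move=> ax; rewrite /p; case: pickP => [b /andP[ab lt]|none] /=.
    by split=> //; have := d_adj _ _ ab; lia.
  have [b ab db] := dist_pred G_conn ax.
  by have := none b; rewrite ab /d db ltnSn.
have p_uniq a b : adj a b -> d b < d a -> a != x /\ p a = b.
  move=> ab lt; have ax : a != x by apply: contraTneq lt => ->; rewrite /d distxx.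
  have [apa dpa] := pP a ax; split=> //; apply/eqP/negPn/negP => pb.
  have := d_neq (p a) a b ax; rewrite adj_sym apa => /(_ isT ab pb).
  by have := d_adj _ _ ab; lia.
exists p, d; split=> [a /pP[_ ->] //|a b|a b ax bx pab pax].
  apply/idP/orP => [ab|[]/andP[/pP[ap _] /eqP <-]] //; last by rewrite adj_sym.
  have [dab|dab] := d_adj _ _ ab.
    by left; have [|ax pb] := p_uniq _ _ ab; [rewrite dab | rewrite /parent_rel ax pb eqxx].
  right; have [||bx pb] := p_uniq b a; [by rewrite adj_sym | by rewrite dab |].
  by rewrite /parent_rel bx pb eqxx.
(* Two distinct children of a vertex other than [x] would be neighbours of it at the same distance
   from [x], against [d_neq]. *)
have [apa da] := pP a ax; have [bpb db] := pP b bx.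
apply/eqP/negPn/negP => ab.
have := d_neq a (p a) b pax apa; rewrite adj_sym in bpb; rewrite pab => /(_ bpb ab).
by rewrite da db pab eqxx.
Qed.

(** A single vertex is never a maximal geodesic, because it has a neighbour. *)
Lemma maximal_geodesic_edge s : 2 <= #|G| -> maximal_geodesic s ->
  exists a b t, s = [:: a, b & t] /\ adj a b.
Proof.
move=> G2 [gs ms]; have := geodesic_sorted G_conn gs.
case: s gs ms => [/geodesic_neq0//|a [|b t]] _ ms /=.
  have [b ab] := neighbour_exists G_conn a G2.
  by case: ms; exists [:: a; b]; split=> //; [exact: geodesic2 | rewrite infix1s mem_head].
by case/andP=> ab _; exists a, b, t.
Qed.

Lemma gt_le S : gt_set S -> gt G <= #|S|.
Proof. by case: (gt_spec G) => _; apply. Qed.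

Lemma gt_gt0 (a : G) : 0 < gt G.
Proof.
have [[S gS <-] _] := gt_spec G.
have [s ms _] := maximal_extension (geodesic1 G_conn a).
by have [y _ yS] := gS s ms; apply/card_gt0P; exists y.
Qed.

Lemma gt_setC1 a : 2 <= #|G| -> gt_set [set~ a].
Proof.
move=> G2 s /(maximal_geodesic_edge G2)[b [c [t [-> bc]]]].
have [ba|ba] := eqVneq b a; last by exists b; rewrite !inE ?eqxx.
exists c; rewrite !inE ?eqxx ?orbT //.
by apply: contraTneq bc => ->; rewrite ba adj_irrefl.
Qed.

Lemma gt_setC2 a b : 2 <= #|G| -> ~~ adj a b -> gt_set (~: [set a; b]).
Proof.
move=> G2 nab s /(maximal_geodesic_edge G2)[u [v [t [-> uv]]]].
have [uab|uab] := boolP (u \in [set a; b]); last by exists u; rewrite !inE ?eqxx // -in_set2.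
exists v; rewrite ?inE ?eqxx ?orbT //.
apply: contraNN nab => vab; move: uab vab uv; rewrite !inE.
by case/orP=> /eqP->; case/orP=> /eqP->; rewrite ?adj_irrefl // adj_sym.
Qed.

(** All distances are at most one, so no geodesic has more than two vertices. *)
Lemma complete_maximal_geodesic a b : complete G -> a != b -> maximal_geodesic [:: a; b].
Proof.
move=> cG ab; split=> [|[t [gt _ lt]]]; first exact/geodesic2/cG.
have ut := geodesic_uniq gt.
case: t gt ut lt => [//|u t] /(geodesicP G_conn)[_ dt] /andP[ut _]; rewrite /= -dt.
have [<-|/cG uv] := eqVneq u (last u t); first by rewrite distxx.
by rewrite dist_adj.
Qed.

Lemma complete_gt : complete G -> #|G| - 1 <= gt G.
Proof.
move=> cG; have [[S gS <-] _] := gt_spec G.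
rewrite leqNgt; apply/negP => lt.
(* Two vertices missed by [S] would form a maximal geodesic disjoint from it. *)
have /card_gt1P[a [b [aS bS ab]]] : 1 < #|~: S| by have := cardsC S; lia.
have [c] := gS _ (complete_maximal_geodesic cG ab).
by rewrite !inE in aS bS *; case/orP=> /eqP->; apply/negP.
Qed.

End GeodesicTransversal.

Theorem proposition3p2 (G : sgraph) (G_conn : connected G) (G_order : 2 <= #|G|) :
  [/\ 1 <= gt G <= #|G| - 1,
      gt G = 1 <-> subdivided_star G
    & gt G = #|G| - 1 <-> complete G /\ 2 <= #|G|].
Proof.
have [a _] : exists a : G, a \in G by apply/card_gt0P; apply: ltnW.
have gt0 := gt_gt0 G_conn a.
have le_gt : gt G <= #|G| - 1.
  by apply: leq_trans (gt_le (gt_setC1 G_conn a G_order)) _; rewrite cardsC1 subn1.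
split; first by rewrite gt0.
- split=> [g1|/spider_of_subdivided_star[x [p [d sp]]]].
    have [[S gS]] := gt_spec G; rewrite g1 => /eqP/cards1P[x Sx] _.
    have [|p [d sp]] := @spider_of_gt_set G G_conn x; first by rewrite -Sx.
    exact: subdivided_star_of_spider sp.
  by apply/eqP; rewrite eqn_leq gt0 andbT -(cards1 x) gt_le //; apply: spider_gt_set sp.
split=> [gE|[cG _]]; last by apply/eqP; rewrite eqn_leq le_gt complete_gt.
split=> // u v uv; apply/negPn/negP => nuv.
(* The complement of a nonadjacent pair is a transversal with [#|G| - 2] elements, fewer than
   [gt G]. *)
have := gt_le (gt_setC2 G_conn G_order nuv); have := cardsC [set u; v].
by rewrite gE cards2 uv; lia.
Qed.
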